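(* For each positive integer $m$, there is a constant $C_m$ (depending only on $m$) such that $$s_{2m}(\mathbb{Z}_2^d) \;\leq\; C_m\, 2^{d/m} + O(1) \quad\text{as } d\to\infty .$$
   Context: $\mathbb{Z}_2^d$ is the additive group of $d$-dimensional vectors over $\mathbb{Z}_2$. For a finite abelian group $G$ and a positive multiple $r$ of its exponent $\exp(G)$, $s_r(G)$ is the smallest integer $s$ such that every sequence of length $s$ over $G$ (repetitions allowed) has a zero-sum subsequence of length $r$ (a subsequence, not necessarily of consecutive terms, whose terms sum to $0$). Here $m$ is fixed, and the implied constant in $O(1)$ may depend on $m$ but not on $d$. *)

(* Defs.v *)
From mathcomp Require Import all_boot all_order all_algebra all_fingroup.
From mathcomp Require Import all_solvable.

Set Implicit Arguments.
Unset Strict Implicit.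
Unset Printing Implicit Defensive.

Import GRing.Theory.

Local Open Scope ring_scope.

(* Every sequence of length s over G has a zero-sum subsequence of length r.
   [subseq u t] allows arbitrary gaps and counts repeated terms of t
   separately. *)
Definition forces_zero_sum (G : finZmodType) (r s : nat) : bool :=
  [forall t : s.-tuple G,
     [exists u : r.-tuple G, subseq u t && (\sum_(x <- u) x == 0)]].

(* If r is a multiple of exp(G), some length forces a zero-sum subsequence of
   length r: among r * #|G| terms, some element of G occurs r times. *)
Lemma ex_forces_zero_sum (G : finZmodType) (r : nat) :
  (exponent [set: G] %| r)%N -> exists s, forces_zero_sum G r s.
Proof.
move=> /exponentP expG; exists (r * #|G|)%N.
apply/forallP => t; apply/existsP.
have [x rx] : exists x : G, (r <= count_mem x t)%N.
  have [r0|r_gt0] := posnP r; first by exists 0; rewrite [leqLHS]r0.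
  apply/existsP; apply: contraT; rewrite negb_exists => /forallP lt_r.
  have : (\sum_(x : G) count_mem x t <= \sum_(x : G) r.-1)%N.
    by apply: leq_sum => x _; rewrite -ltnS prednK // ltnNge.
  have -> : (\sum_(x : G) count_mem x t = size t)%N.
    elim: (tval t) => [|y s IHs] /=; first by rewrite big1.
    rewrite big_split /= IHs (bigD1 y) //= eqxx big1 ?addn0 //.
    by move=> z /negPf; rewrite eq_sym => ->.
  rewrite size_tuple sum_nat_const mulnC leqNgt ltn_pmul2l ?prednK ?leqnn //.
  by apply/card_gt0P; exists 0.
exists (nseq_tuple r x); apply/andP; split; last first.
  rewrite big_nseq -Monoid.iteropE.
  by have := expG x (in_setT x); rewrite FinRing.zmodXgE => /eqP.
have /= sub_filter := filter_subseq (pred1 x) t.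
apply: subseq_trans sub_filter.
have -> : filter (pred1 x) t = nseq (count_mem x t) x.
  rewrite -size_filter; apply/all_pred1P; exact: filter_all.
by rewrite -(subnK rx) addnC nseqD prefix_subseq.
Qed.

(* s_r(G), for r a multiple of exp(G). *)
Definition zero_sum_const (G : finZmodType) (r : nat)
    (expGr : (exponent [set: G] %| r)%N) : nat :=
  ex_minn (ex_forces_zero_sum expGr).

Arguments zero_sum_const G r expGr : clear implicits.

Lemma exponent_Z2_dvd (m d : nat) :
  (exponent [set: 'rV['Z_2]_d] %| 2 * m)%N.
Proof.
apply/exponentP => x _; rewrite FinRing.zmodXgE mulrnA.
suff -> : x *+ 2 = 0 by rewrite mul0rn.
by apply/rowP => i; rewrite mulmxnE mxE; apply: val_inj; case: (x _ _) => [[|[]]].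
Qed.

(* Main.v *)
Require Import Defs.
From mathcomp Require Import all_boot all_order all_algebra.
From mathcomp Require Import all_classical all_reals all_analysis.
Import Order.TTheory GRing.Theory Num.Theory numFieldNormedType.Exports.

Local Open Scope classical_set_scope.
Local Open Scope ring_scope.

(** The proof is Ruzsa's energy method for symmetric linear equations, carried
    out in characteristic 2.  Given a sequence [a] of length [s], let [E k] be
    the number of zero-sum [2k]-tuples of positions, repetitions allowed.

    If no [2m] distinct positions have sum zero, then every tuple counted by
    [E m] repeats a position; the two equal terms cancel, so deleting them
    leaves a zero-sum tuple of length [2(m-1)].  There are [s] choices for the
    repeated position and at most [K = 2m(2m-1)] for the ordered pair of places
    where it stands, whence [E m <= K s * E (m-1)]
    ([repeated_position_bound]).

    On the other hand [E] is log-convex ([energy_log_convex]): splitting a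
    tuple of length [2k] as [(k-1) + (k+1)] instead of [k + k] and applying the
    Cauchy-Schwarz inequality gives [E k ^ 2 <= E (k-1) * E (k+1)].  Hence all
    the ratios [E k / E (k-1)] with [k <= m] are at most [K s], and since
    [E 0 = 1], [E m <= (K s) ^ m] ([energy_upper_bound]).

    Finally [E m >= s ^ (2m) / 2 ^ d], again by Cauchy-Schwarz, because
    [s ^ m] tuples of length [m] have only [2 ^ d] possible sums.  Comparing
    the two bounds yields [s ^ m <= K ^ m * 2 ^ d], that is
    [s <= K * 2 ^ (d / m)].  Since positions rather than values are compared,
    a sequence with repeated terms is handled in the same way as a set. *)

(** * Finite sums and finite functions *)

Lemma nat_Cauchy_Schwarz (T : finType) (f g : T -> nat) :
  ((\sum_x f x * g x) ^ 2 <= (\sum_x f x ^ 2) * (\sum_x g x ^ 2))%N.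
Proof.
(* Twice the inequality is the sum over all pairs (x, y) of the inequality
   2 u v <= u ^ 2 + v ^ 2 at u = f x * g y and v = f y * g x. *)
rewrite -(@leq_pmul2l 2) // expnS expn1 !big_distrlr /=.
rewrite [leqRHS]mul2n -addnn [in X in (_ <= _ + X)%N]exchange_big /=.
rewrite -big_split big_distrr; apply: leq_sum => x _ /=.
rewrite -big_split big_distrr; apply: leq_sum => y _ /=.
have [le_xy _] := nat_Cauchy (f x * g y) (f y * g x).
by rewrite -!expnMn mulnACA [(g x * g y)%N]mulnC -mulnACA.
Qed.

Definition insert_at {I : Type} {k : nat} (p : 'I_k.+1)
    (u : I * {ffun 'I_k -> I}) : {ffun 'I_k.+1 -> I} :=
  [ffun x => if unlift p x is Some y then u.2 y else u.1].

Lemma insert_at_bij (I : finType) (k : nat) (p : 'I_k.+1) :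
  bijective (@insert_at I k p).
Proof.
exists (fun f : {ffun 'I_k.+1 -> I} => (f p, [ffun y => f (lift p y)])).
- move=> [i f]; rewrite /insert_at ffunE unlift_none; congr (_, _).
  by apply/ffunP => y; rewrite !ffunE liftK.
- move=> f; apply/ffunP => x; rewrite ffunE.
  by case: unliftP => [y ->|->] //=; rewrite ffunE.
Qed.

Lemma insert_at_same I k p u : @insert_at I k p u p = u.1.
Proof. by rewrite ffunE unlift_none. Qed.

Lemma insert_at_lift I k p u y : @insert_at I k p u (lift p y) = u.2 y.
Proof. by rewrite ffunE liftK. Qed.

(** * Counting tuples of positions by their sum *)

Section Representations.

Variables (G : finZmodType) (I : finType) (a : I -> G).

Definition tuple_sum {k : nat} (f : {ffun 'I_k -> I}) : G := \sum_j a (f j).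

Definition rep (k : nat) (x : G) : nat :=
  (\sum_(f : {ffun 'I_k -> I}) (tuple_sum f == x))%N.

Lemma tuple_sum_insert k (p : 'I_k.+1) u :
  tuple_sum (insert_at p u) = a u.1 + tuple_sum u.2.
Proof.
rewrite /tuple_sum (bigD1_ord p) //= insert_at_same; congr (_ + _).
by apply: eq_bigr => j _; rewrite insert_at_lift.
Qed.

Lemma sum_insert k (p : 'I_k.+1) (F : {ffun 'I_k.+1 -> I} -> nat) :
  (\sum_f F f = \sum_i \sum_g F (insert_at p (i, g)))%N.
Proof.
rewrite (reindex (insert_at p)) /=; last exact/onW_bij/insert_at_bij.
by rewrite pair_bigA; apply: eq_bigr => -[].
Qed.

Lemma rep0 x : rep 0 x = (x == 0).
Proof.
rewrite /rep (eq_bigr (fun=> nat_of_bool (x == 0))).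
  by rewrite sum_nat_const card_ffun card_ord expn0 mul1n.
by move=> f _; rewrite /tuple_sum big_ord0 eq_sym.
Qed.

Lemma repS k x : (rep k.+1 x = \sum_i rep k (x - a i)%R)%N.
Proof.
rewrite /rep (sum_insert _ ord0); apply: eq_bigr => i _; apply: eq_bigr => g _.
by rewrite tuple_sum_insert /= [in RHS]eq_sym subr_eq eq_sym addrC.
Qed.

Lemma sum_rep k : (\sum_x rep k x = #|I| ^ k)%N.
Proof.
rewrite /rep exchange_big /= (eq_bigr (fun=> 1%N)).
  by rewrite sum1_card card_ffun card_ord.
move=> f _; rewrite (bigD1 (tuple_sum f)) //= eqxx big1 // => x.
by rewrite eq_sym => /negPf ->.
Qed.

(** The number of pairs of [k]-tuples with equal sums; in characteristic 2
    these pairs are the zero-sum [2k]-tuples, see [energy_rep]. *)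
Definition energy (k : nat) : nat := (\sum_x rep k x ^ 2)%N.

Lemma energy_lower_bound k : ((#|I| ^ k) ^ 2 <= #|G| * energy k)%N.
Proof.
have := nat_Cauchy_Schwarz G (fun=> 1%N) (rep k).
under eq_bigr do rewrite mul1n.
by rewrite sum_rep sum_nat_const exp1n muln1.
Qed.

Lemma energy_gt0 k : (0 < #|I|)%N -> (0 < energy k)%N.
Proof.
move=> I_gt0; have := energy_lower_bound k.
by case: (energy k) => //; rewrite muln0 leqn0 !expn_eq0 eqn0Ngt I_gt0.
Qed.

Hypothesis char2 : forall x : G, x + x = 0.

Lemma oppr_char2 (x : G) : - x = x.
Proof. by apply/eqP; rewrite eq_sym -addr_eq0 char2. Qed.

(** In characteristic 2 a term may be moved freely from one side of an
    equation between two sums to the other. *)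
Lemma sum_rep_shift j k :
  (\sum_x rep j.+1 x * rep k x = \sum_x rep j x * rep k.+1 x)%N.
Proof.
under eq_bigr do rewrite repS big_distrl.
under [RHS]eq_bigr do rewrite repS big_distrr.
rewrite exchange_big [RHS]exchange_big; apply: eq_bigr => i _ /=.
have bij_shift : bijective (fun x : G => x + a i).
  by exists (fun x => x - a i) => x; rewrite ?addrK ?subrK.
rewrite (reindex _ (onW_bij _ bij_shift)) /=.
by apply: eq_bigr => x _; rewrite addrK oppr_char2.
Qed.

Lemma energy_rep k : energy k = rep k.*2 0.
Proof.
have shift j l : (\sum_x rep j x * rep l x = rep (j + l) 0%R)%N.
  elim: j l => [|j IHj] l; last by rewrite sum_rep_shift IHj addnS addSn.
  rewrite (bigD1 0) //= rep0 eqxx mul1n big1 ?addn0 // => x /negPf x0.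
  by rewrite rep0 x0.
by rewrite -addnn -shift; apply: eq_bigr => x _; rewrite expnS expn1.
Qed.

(** Counting the same zero-sum tuples of length [2(k+1)] as [k + (k+2)] makes
    [energy k.+1] an inner product of [rep k] and [rep k.+2], to which
    Cauchy-Schwarz applies. *)
Lemma energy_log_convex k : (energy k.+1 ^ 2 <= energy k * energy k.+2)%N.
Proof.
have -> : energy k.+1 = (\sum_x rep k x * rep k.+2 x)%N.
  by rewrite -sum_rep_shift; apply: eq_bigr => x _; rewrite expnS expn1.
exact: nat_Cauchy_Schwarz.
Qed.

(** For fixed places [p] and [lift p q], the tuples taking the same value there
    are counted by that value and by the remaining [k] entries, on which the
    sum is unchanged because the two equal terms cancel. *)
Lemma coincidence_count k (p : 'I_k.+2) (q : 'I_k.+1) :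
  (\sum_(f : {ffun 'I_k.+2 -> I})
      ((f p == f (lift p q)) && (tuple_sum f == 0%R)) = #|I| * rep k 0%R)%N.
Proof.
rewrite (sum_insert _ p) -sum_nat_const; apply: eq_bigr => i _ /=.
rewrite (sum_insert _ q) (bigD1 i) //= [X in (_ + X)%N]big1 => [|j ji].
  rewrite addn0; apply: eq_bigr => g _.
  rewrite insert_at_lift !insert_at_same /= eqxx !tuple_sum_insert /=.
  by rewrite addrA char2 add0r.
rewrite big1 // => g _; rewrite insert_at_lift !insert_at_same /=.
by rewrite eq_sym (negPf ji).
Qed.

(** Every zero-sum tuple takes the same value at two of its places, so it is
    counted in [coincidence_count] for at least one of the [k.+2 * k.+1] pairs
    of places. *)
Lemma repeated_position_bound k :
  (forall f : {ffun 'I_k.+2 -> I}, injective f -> tuple_sum f != 0) ->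
  (rep k.+2 0%R <= k.+2 * k.+1 * #|I| * rep k 0%R)%N.
Proof.
move=> no_inj.
have -> : (k.+2 * k.+1 * #|I| * rep k 0%R = \sum_(f : {ffun 'I_k.+2 -> I})
    \sum_(p < k.+2) \sum_(q < k.+1)
      ((f p == f (lift p q)) && (tuple_sum f == 0%R)))%N.
  rewrite exchange_big /=; under [RHS]eq_bigr do rewrite exchange_big /=.
  under [RHS]eq_bigr do under eq_bigr do rewrite coincidence_count.
  by rewrite !sum_nat_const !card_ord !mulnA.
apply: leq_sum => f _; case: eqP => //= sum0.
have /fintype.injectivePn[p [x xp fpx]] : ~~ injectiveb f.
  by apply/negP => /fintype.injectiveP/no_inj; rewrite sum0 eqxx.
have [q x_def] : exists q, x = lift p q.
  by case: (unliftP p x) => [q ->|px]; [exists q | rewrite px eqxx in xp].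
by rewrite (bigD1 p) //= (bigD1 q) //= -x_def fpx eqxx.
Qed.

(** By log-convexity the ratio [energy j.+1 / energy j] grows with [j], so a
    bound on its last value bounds all of them; the product telescopes down to
    [energy 0 = 1]. *)
Lemma energy_upper_bound K n : (0 < #|I|)%N ->
  (energy n.+1 <= K * energy n)%N -> (energy n.+1 <= K ^ n.+1)%N.
Proof.
move=> I_gt0; elim: n => [|n IHn] le_ratio.
  suff E0 : energy 0 = 1%N by move: le_ratio; rewrite E0 muln1 expn1.
  by rewrite energy_rep rep0 eqxx.
apply: (leq_trans le_ratio); rewrite expnS leq_mul2l IHn ?orbT //.
rewrite -(leq_pmul2l (energy_gt0 n.+1 I_gt0)) -{1}[energy n.+1]expn1 -expnSr.
apply: leq_trans (energy_log_convex n) _.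
by rewrite mulnA [(energy n.+1 * K)%N]mulnC mulnC leq_mul2r le_ratio orbT.
Qed.

(** * Sequences without a zero-sum subsequence of prescribed even length *)

(** The upper bound [(K * s) ^ n.+1] and the lower bound [s ^ (2(n+1)) / #|G|]
    for [energy n.+1], compared after cancelling a factor [s ^ n.+1]. *)
Lemma no_zero_sum_bound n :
  (forall f : {ffun 'I_(n.*2).+2 -> I}, injective f -> tuple_sum f != 0) ->
  (#|I| ^ n.+1 <= (n.+1.*2 * (n.*2).+1) ^ n.+1 * #|G|)%N.
Proof.
move=> /repeated_position_bound; rewrite -doubleS -!energy_rep => le_ratio.
have [I0|I_gt0] := posnP #|I|; first by rewrite I0 exp0n.
have upper := energy_upper_bound _ _ I_gt0 le_ratio.
have pow_gt0 : (0 < #|I| ^ n.+1)%N by rewrite expn_gt0 I_gt0.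
rewrite -(leq_pmul2r pow_gt0) mulnn.
apply: leq_trans (energy_lower_bound n.+1) _.
by rewrite mulnAC -expnMn mulnC leq_mul2r upper orbT.
Qed.

End Representations.

(** An injective choice of positions, listed in increasing order, is a
    subsequence with the same sum. *)
Lemma zero_sum_subseq (G : finZmodType) (s r : nat) (t : s.-tuple G)
    (f : {ffun 'I_r -> 'I_s}) :
  injective f -> tuple_sum G _ (tnth t) f = 0 ->
  [exists u : r.-tuple G, subseq u t && (\sum_(x <- u) x == 0)].
Proof.
move=> f_inj sum0; pose A := f @: 'I_r.
have sizeA : size [seq tnth t i | i <- enum A] == r.
  by rewrite size_map -cardE card_imset // card_ord.
apply/existsP; exists (Tuple sizeA); apply/andP; split => /=.
  rewrite -[X in subseq _ X](map_tnth_enum t) map_subseq //.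
  by rewrite [X in subseq _ X]enumT filter_subseq.
rewrite big_map big_enum /= big_imset /=; last by move=> ? ? _ _ /f_inj.
by rewrite -[eqbRHS]sum0; apply/eqP/eq_bigl => i; rewrite inE.
Qed.

(** By minimality some sequence one term shorter than the constant has no
    zero-sum subsequence of length [2(n+1)]; this costs the predecessor here
    and gives the additive constant 1 in the final estimate. *)
Lemma zero_sum_const_bound (n d : nat) :
  let s := (zero_sum_const 'rV['Z_2]_d (2 * n.+1) (exponent_Z2_dvd n.+1 d)).-1 in
  (s ^ n.+1 <= (n.+1.*2 * (n.*2).+1) ^ n.+1 * 2 ^ d)%N.
Proof.
rewrite /zero_sum_const; case: ex_minnP => -[|s] _ s_min /=; first by rewrite exp0n.
have /forallPn[t no_sub] : ~~ forces_zero_sum 'rV['Z_2]_d (2 * n.+1) s.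
  by apply/negP => /s_min; rewrite ltnn.
have char2 (x : 'rV['Z_2]_d) : x + x = 0.
  by apply/rowP => i; rewrite !mxE; apply: val_inj; case: (x _ _) => [[|[]]].
have := no_zero_sum_bound _ _ (tnth t) char2 n.
rewrite !card_ord card_mx card_ord mul1n; apply => f f_inj.
apply: contra no_sub => /eqP sum0.
by move: f f_inj sum0; rewrite -doubleS -mul2n => f; apply: zero_sum_subseq.
Qed.

Theorem mainTheorem2 (R : realType) (m : nat) (m_gt0 : (0 < m)%N) :
  exists (C : R) (g : nat -> R),
    g =O_\oo (fun _ : nat => 1 : R) /\
    forall d : nat,
      (zero_sum_const 'rV['Z_2]_d (2 * m) (exponent_Z2_dvd m d))%:R
        <= C * 2 `^ (d%:R / m%:R) + g d.
Proof.
case: m m_gt0 => // n _.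
exists (n.+1.*2 * (n.*2).+1)%:R, (fun=> 1); split.
  by apply/eqOP; near=> k; near=> x; rewrite normr1 mulr1; near: k; exact: nbhs_pinfty_ge.
move=> d; have := zero_sum_const_bound n d.
set z := zero_sum_const _ _ _; set K := (_.*2 * _)%N => bound.
have z_le : z%:R <= z.-1%:R + 1 :> R by rewrite natr1 ler_nat leqSpred.
apply: le_trans z_le _; rewrite lerD2r.
rewrite -(@ler_pXn2r _ n.+1) ?nnegrE ?mulr_ge0 ?powR_ge0 //.
rewrite exprMn -[X in _ * X]powR_mulrn ?powR_ge0 // -powRrM divfK ?pnatr_eq0 //.
by rewrite powR_mulrn // -!natrX -natrM ler_nat.
Unshelve. all: by end_near.
Qed.
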